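(* Let $X$ be a random variable having the RTGLE$(\alpha,\beta,\gamma,p)$ distribution, where $\alpha\ge 0$, $\beta\ge 0$, $(\alpha,\beta)\neq(0,0)$, $\gamma>0$ and $p\in[0,1]$, and let $$h(x)=\frac{\gamma(\alpha+\beta x)\left(\alpha x+\frac{\beta x^{2}}{2}\right)^{\gamma-1}\left[1-p+p\left(\alpha x+\frac{\beta x^{2}}{2}\right)^{\gamma}\right]}{1+p\left(\alpha x+\frac{\beta x^{2}}{2}\right)^{\gamma}},\quad x>0,$$ be the hazard function of $X$. Then: (i) $h$ is an increasing function on $(0,\infty)$ if $\gamma\ge 1$; (ii) $h$ is a decreasing function on $(0,\infty)$ if $\beta=0$ and $0<\gamma<0.5$.
   Context: The record-based transmuted generalized linear exponential distribution RTGLE$(\alpha,\beta,\gamma,p)$, with parameters $\alpha\ge 0$, $\beta\ge 0$ (not both zero), $\gamma>0$, $p\in[0,1]$, is the distribution on $(0,\infty)$ with distribution function $$F(x)=1-\left[1+p\left(\alpha x+\frac{\beta x^{2}}{2}\right)^{\gamma}\right]e^{-\left(\alpha x+\frac{\beta x^{2}}{2}\right)^{\gamma}},\quad x>0,$$ and density $f=F'$. The hazard function is $h(x)=f(x)/(1-F(x))$. ''Increasing'' and ''decreasing'' are understood in the weak sense (nondecreasing, nonincreasing), as usual for increasing/decreasing failure rate; e.g. for $\gamma=1$, $\beta=0$, $p=0$ the hazard function is constant. *)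

(* Defs.v *)
From HB Require Import structures.
From mathcomp Require Import all_boot all_order all_algebra.
From mathcomp Require Import all_classical all_reals all_analysis.

Set Implicit Arguments.
Unset Strict Implicit.
Unset Printing Implicit Defensive.

Import Order.TTheory GRing.Theory Num.Theory.
Import numFieldNormedType.Exports.

Local Open Scope classical_set_scope.
Local Open Scope ring_scope.

Definition gle_arg (R : realType) (alpha beta x : R) : R :=
  alpha * x + beta * x ^+ 2 / 2.

(* The distribution is supported on (0, +oo), hence the value 0 for x <= 0. *)
Definition rtgle_cdf (R : realType) (alpha beta gamma p x : R) : R :=
  let t := gle_arg alpha beta x `^ gamma in
  if 0 < x then 1 - (1 + p * t) * expR (- t) else 0.

Definition has_rtgle_distribution (d : measure_display) (T : measurableType d)
    (R : realType) (P : probability T R) (X : {RV P >-> R})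
    (alpha beta gamma p : R) : Prop :=
  forall x : R, cdf X x = (rtgle_cdf alpha beta gamma p x)%:E.

Definition cdf_real (d : measure_display) (T : measurableType d)
    (R : realType) (P : probability T R) (X : {RV P >-> R}) (x : R) : R :=
  fine (cdf X x).

(* Meaningful only where the distribution function is differentiable and
   smaller than 1. *)
Definition hazard (d : measure_display) (T : measurableType d)
    (R : realType) (P : probability T R) (X : {RV P >-> R}) (x : R) : R :=
  derive1 (cdf_real X) x / (1 - cdf_real X x).

(* Main.v *)
(* Put u = alpha x + beta x^2 / 2 and t = u^gamma. Differentiating the
   distribution function gives
     h = gamma (alpha + beta x) u^(gamma - 1) q(t),
     q(t) = (1 - p + p t) / (1 + p t) = 1 - p / (1 + p t).
   For gamma >= 1 every factor is nonnegative and nondecreasing. For beta = 0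
   and gamma < 1/2, write u^(gamma - 1) = u^(2 gamma - 1) / t: the factors
   u^(2 gamma - 1) and q(t) / t = ((1 - p) / t + p) / (1 + p t) are both
   nonincreasing, so no second differentiation is needed. *)
Require Import Defs.
From HB Require Import structures.
From mathcomp Require Import all_boot all_order all_algebra.
From mathcomp Require Import all_classical all_reals all_analysis.
From mathcomp Require Import ring lra.

Set Implicit Arguments.
Unset Strict Implicit.
Unset Printing Implicit Defensive.

Import Order.TTheory GRing.Theory Num.Theory.
Import numFieldNormedType.Exports.

Local Open Scope classical_set_scope.
Local Open Scope ring_scope.

Lemma nonincreasing_powR (R : realType) (r x y : R) :
  r <= 0 -> 0 < x -> x <= y -> y `^ r <= x `^ r.
Proof.
move=> r0 x0 xy; have y0 := lt_le_trans x0 xy.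
by rewrite -[r]opprK !(powRN _ (- r)) lef_pV2 ?posrE ?powR_gt0//
  ge0_ler_powR ?oppr_ge0// nnegrE ltW.
Qed.

Lemma gle_arg_gt0 (R : realType) (alpha beta x : R) :
  0 <= alpha -> 0 <= beta -> (alpha, beta) <> (0, 0) -> 0 < x ->
  0 < gle_arg alpha beta x.
Proof.
rewrite /gle_arg le_eqVlt => /predU1P[<-|alpha0] beta0 ab0 x0.
  have beta_gt0 : 0 < beta.
    by rewrite lt_def beta0 andbT; apply/eqP => b0; apply: ab0; rewrite b0.
  by rewrite mul0r add0r divr_gt0// mulr_gt0// exprn_gt0.
by apply: ltr_wpDr; [rewrite divr_ge0// mulr_ge0// sqr_ge0|exact: mulr_gt0].
Qed.

Lemma is_derive_gle_arg (R : realType) (alpha beta x : R) :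
  is_derive x 1 (gle_arg alpha beta) (alpha + beta * x).
Proof.
rewrite /gle_arg; apply: is_derive_eq.
by rewrite /GRing.scale /=; field.
Qed.

(** With t' = gamma (alpha + beta x) u^(gamma - 1), the product rule gives -p t' e^(-t) + (1 + p t)
    t' e^(-t), and the two terms collect to t' (1 - p + p t) e^(-t). *)
Lemma is_derive_rtgle_cdf (R : realType) (alpha beta gamma p x : R) :
  0 < x -> 0 < gle_arg alpha beta x ->
  let t := gle_arg alpha beta x `^ gamma in
  is_derive x 1 (rtgle_cdf alpha beta gamma p)
    (gamma * (alpha + beta * x) * gle_arg alpha beta x `^ (gamma - 1)
       * (1 - p + p * t) * expR (- t)).
Proof.
move=> x0 u0 t.
pose T (y : R) := gle_arg alpha beta y `^ gamma.
have dT : is_derive x 1 T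
    ((alpha + beta * x) * (gamma * gle_arg alpha beta x `^ (gamma - 1))).
  have dp := is_derive1_powR gamma u0.
  have dg := is_derive_gle_arg alpha beta x.
  have := @is_derive1_comp _ _ _ _ _ _ dp dg.
  by rewrite mulrC.
pose G (y : R) := 1 - (1 + p * T y) * expR (- T y).
have dG : is_derive x 1 G (gamma * (alpha + beta * x)
    * gle_arg alpha beta x `^ (gamma - 1) * (1 - p + p * t) * expR (- t)).
  apply: is_derive_eq.
  by rewrite /GRing.scale /= -[T x]/t; ring.
(* The case distinction in [rtgle_cdf] is harmless: (0, +oo) is open, so the function agrees with
   [G] on a neighbourhood of x. *)
apply: near_eq_is_derive dG.
near=> y.
have y0 : 0 < y by near: y; exact: lt_nbhsr.
by rewrite /rtgle_cdf y0.
Unshelve. all: by end_near. Qed.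

Lemma cdf_realE (d : measure_display) (T : measurableType d) (R : realType)
    (P : probability T R) (X : {RV P >-> R}) (alpha beta gamma p : R) :
  has_rtgle_distribution X alpha beta gamma p ->
  cdf_real X = rtgle_cdf alpha beta gamma p.
Proof. by move=> XF; apply/funext => x; rewrite /cdf_real XF. Qed.

(** After cross-multiplication the difference of the two sides is p (p t - p s), a product of
    nonnegative factors. *)
Lemma mixing_factor_nondecreasing (R : realFieldType) (p s t : R) :
  0 <= p <= 1 -> 0 <= s -> s <= t ->
  (1 - p + p * s) / (1 + p * s) <= (1 - p + p * t) / (1 + p * t).
Proof.
move=> /andP[p0 p1] s0 st.
have ps : 0 <= p * s by rewrite mulr_ge0.
have pst : p * s <= p * t by rewrite ler_wpM2l.
rewrite ler_pdivrMr; last lra.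
rewrite mulrAC ler_pdivlMr; last lra.
nra.
Qed.

Lemma mixing_factor_div_nonincreasing (R : realFieldType) (p s t : R) :
  0 <= p <= 1 -> 0 < s -> s <= t ->
  (1 - p + p * t) / (1 + p * t) / t <= (1 - p + p * s) / (1 + p * s) / s.
Proof.
move=> /andP[p0 p1] s0 st.
have t0 : 0 < t by exact: lt_le_trans st.
(* The factor (1 - p + p r) / (1 + p r) is itself nondecreasing; moving the division by r into its
   numerator leaves two nonnegative nonincreasing factors. *)
have E (r : R) : 0 < r ->
    (1 - p + p * r) / (1 + p * r) / r = ((1 - p) / r + p) / (1 + p * r).
  move=> r0; have pr : 0 <= p * r by rewrite mulr_ge0// ltW.
  by field; rewrite !gt_eqF//; lra.
rewrite !E//.
have ps : 0 <= p * s by rewrite mulr_ge0// ltW.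
have pst : p * s <= p * t by rewrite ler_wpM2l.
apply: ler_pM.
- by rewrite addr_ge0// divr_ge0 ?subr_ge0// ltW.
- by rewrite invr_ge0; lra.
- by rewrite lerD2r ler_wpM2l ?subr_ge0// lef_pV2.
- by rewrite lef_pV2 ?posrE; lra.
Qed.

(** Since [derive1] and division are total, the first conjunct certifies that [hazard] takes no
    default value on (0, +oo). *)
Theorem theorem2 (R : realType) (d : measure_display) (T : measurableType d)
    (P : probability T R) (X : {RV P >-> R}) (alpha beta gamma p : R)
    (alpha_ge0 : 0 <= alpha) (beta_ge0 : 0 <= beta)
    (alpha_beta_neq0 : (alpha, beta) <> (0, 0))
    (gamma_gt0 : 0 < gamma) (p01 : 0 <= p <= 1)
    (X_rtgle : has_rtgle_distribution X alpha beta gamma p) :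
  [/\ (forall x : R, 0 < x ->
         derivable (cdf_real X) x 1 /\ cdf_real X x < 1 /\
         hazard X x =
           gamma * (alpha + beta * x) * gle_arg alpha beta x `^ (gamma - 1)
           * (1 - p + p * gle_arg alpha beta x `^ gamma)
           / (1 + p * gle_arg alpha beta x `^ gamma)),
      (1 <= gamma -> {in `]0, +oo[ &, nondecreasing_fun (hazard X)}) &
      (beta = 0 -> gamma < 2^-1 ->
         {in `]0, +oo[ &, nonincreasing_fun (hazard X)})].
Proof.
have /andP[p0 p1] := p01.
have u_gt0 (x : R) : 0 < x -> 0 < gle_arg alpha beta x by exact: gle_arg_gt0.
have u_le (x y : R) : 0 < x -> x <= y ->
    gle_arg alpha beta x <= gle_arg alpha beta y.
  move=> x0 xy; rewrite /gle_arg lerD// ?ler_wpM2l// ler_wpM2r ?invr_ge0//.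
  by rewrite ler_wpM2l// lerXn2r// nnegrE ltW// (lt_le_trans x0).
have H (x : R) : 0 < x ->
    derivable (cdf_real X) x 1 /\ cdf_real X x < 1 /\
    hazard X x =
      gamma * (alpha + beta * x) * gle_arg alpha beta x `^ (gamma - 1)
      * (1 - p + p * gle_arg alpha beta x `^ gamma)
      / (1 + p * gle_arg alpha beta x `^ gamma).
  move=> x0; have dF := is_derive_rtgle_cdf gamma p x0 (u_gt0 _ x0).
  have D0 : 0 < 1 + p * gle_arg alpha beta x `^ gamma.
    by rewrite ltr_wpDr// mulr_ge0// powR_ge0.
  have e0 := expR_gt0 (- gle_arg alpha beta x `^ gamma).
  rewrite /hazard (cdf_realE X_rtgle) derive1E derive_val; split=> //.
  rewrite /rtgle_cdf x0; split; first by rewrite gtrBl mulr_gt0.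
  (* Here 1 - F = (1 + p t) e^(-t), so the exponential cancels against the one in the density. *)
  by rewrite subKr -mulf_div divff ?gt_eqF// mulr1.
have [tx tle] : (forall x : R, 0 < x -> 0 < gle_arg alpha beta x `^ gamma) /\
    (forall x y : R, 0 < x -> x <= y ->
      gle_arg alpha beta x `^ gamma <= gle_arg alpha beta y `^ gamma).
  split=> [x x0|x y x0 xy]; first by rewrite powR_gt0// u_gt0.
  by rewrite ge0_ler_powR ?nnegrE ?u_le// ltW// u_gt0// (lt_le_trans x0).
have q0 (x : R) : 0 < x -> 0 <= (1 - p + p * gle_arg alpha beta x `^ gamma)
    / (1 + p * gle_arg alpha beta x `^ gamma).
  move=> /tx/ltW t0.
  by rewrite divr_ge0// addr_ge0 ?subr_ge0// mulr_ge0.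
split=> // [gamma1 x y|b0 gamma2 x y].
  rewrite !in_itv/= !andbT => x0 y0 xy.
  have [_ [_ ->]] := H x x0; have [_ [_ ->]] := H y y0.
  rewrite -!mulrA.
  rewrite ler_wpM2l ?(ltW gamma_gt0)//.
  apply: ler_pM.
  - by rewrite addr_ge0// mulr_ge0// ltW.
  - by rewrite mulr_ge0 ?powR_ge0 ?q0.
  - by rewrite lerD2l ler_wpM2l.
  apply: ler_pM; rewrite ?powR_ge0 ?q0//.
    (* The exponent gamma - 1 is nonnegative because gamma >= 1. *)
    by rewrite ge0_ler_powR ?subr_ge0 ?nnegrE ?u_le// ltW// u_gt0.
  by apply: mixing_factor_nondecreasing; rewrite ?tle// ltW// tx.
rewrite !in_itv/= !andbT => x0 y0 xy.
have K (z : R) : 0 < z -> hazard X z = gamma * alpha *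
   (gle_arg alpha beta z `^ (2 * gamma - 1) *
    ((1 - p + p * gle_arg alpha beta z `^ gamma)
    / (1 + p * gle_arg alpha beta z `^ gamma) / gle_arg alpha beta z `^ gamma)).
  move=> z0; have [_ [_ ->]] := H z z0.
  have -> : 2 * gamma - 1 = (gamma - 1) + gamma by ring.
  rewrite [_ `^ (_ + gamma)]powRD ?(gt_eqF (u_gt0 _ z0)) ?implybT//.
  (* Only this [beta] is replaced: the linear factor becomes the constant alpha, while u stays
     folded for the positivity and monotonicity facts. *)
  rewrite [beta in alpha + beta * _]b0.
  have t0 := tx z z0; field; rewrite !gt_eqF//.
  by rewrite ltr_wpDr// mulr_ge0// ltW.
rewrite !K// ler_wpM2l ?mulr_ge0 ?(ltW gamma_gt0)//.
apply: ler_pM; first exact: powR_ge0.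
- by rewrite divr_ge0 ?q0// powR_ge0.
(* The bound gamma < 1/2 enters here, as 2 gamma - 1 <= 0. *)
- by apply: nonincreasing_powR; rewrite ?u_gt0 ?u_le//; lra.
- by apply: mixing_factor_div_nonincreasing; rewrite ?tx ?tle.
Qed.
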